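(* The order dimension of a finite poset $P$ is equal to the smallest $d$ such that there exist order-preserving maps $\eta_1,\ldots,\eta_d:P\to\mathbb N$ such that for each subcritical pair $(j,m)$ of $P$ there is some $i\in\{1,\ldots,d\}$ such that $\eta_i$ reverses $(j,m)$.
   Context: The order dimension of a finite poset $P$ is the smallest $d$ such that $P$ can be written as the intersection (as relations) of $d$ linear extensions of $P$; equivalently (Dushnik–Miller), the smallest $d$ such that $P$ embeds as an induced subposet of $\mathbb R^d$ with the componentwise order. A pair $(j,m)$ of elements of a poset $P$ is subcritical if: (i) $j\not\le m$; (ii) for all $x\in P$, if $x<j$ then $x\le m$; (iii) for all $x\in P$, if $x>m$ then $x\ge j$. A map $\eta:P\to Q$ of posets is order-preserving if $x\le y$ in $P$ implies $\eta(x)\le\eta(y)$ in $Q$. An order-preserving map $\eta$ reverses a subcritical pair $(j,m)$ if $\eta(m)<\eta(j)$ (strict inequality). $\mathbb N$ carries its usual total order. *)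

(* Defs.v *)
From mathcomp Require Import all_boot all_order.
From mathcomp Require Import boolp.

Set Implicit Arguments.
Unset Strict Implicit.
Unset Printing Implicit Defensive.

Import Order.TTheory.
Local Open Scope order_scope.

Definition is_smallest (A : nat -> Prop) (n : nat) : Prop :=
  A n /\ forall k : nat, A k -> (n <= k)%N.

Section Poset.
Context {disp : Order.disp_t} {P : finPOrderType disp}.

Definition linear_extension (L : rel P) : Prop :=
  [/\ reflexive L, antisymmetric L, transitive L, total L
    & forall x y : P, x <= y -> L x y].

Definition subcritical (j m : P) : Prop :=
  [/\ ~ (j <= m),
      forall x : P, x < j -> x <= m
    & forall x : P, m < x -> j <= x].

Definition reverses {disp' : Order.disp_t} {Q : porderType disp'}
    (eta : P -> Q) (j m : P) : Prop :=
  eta m < eta j.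

End Poset.

(* The empty intersection (n = 0) is the full relation on P, so exactly the
   posets with at most one element have dimension 0, in accordance with
   embeddings into R^0. *)
Definition intersection_of_linear_extensions
    {disp : Order.disp_t} (P : finPOrderType disp) (n : nat) : Prop :=
  exists L : 'I_n -> rel P,
    (forall i, linear_extension (L i)) /\
    (forall x y : P, x <= y <-> forall i, L i x y).

Section Existence.
Context {disp : Order.disp_t} (P : finPOrderType disp).

(* Compares x and y by whether they are above a, breaking ties with a fixed
   linear extension of P (size of the down-set, then rank in the enumeration). *)
Let key (a x : P) : nat *l (nat *l nat) :=
  (nat_of_bool (a <= x), (#|[set z | z <= x]|, nat_of_ord (enum_rank x))).

Let ext (a : P) : rel P := fun x y => key a x <= key a y.

Let key_inj a : injective (key a).
Proof. by move=> x y [] _ _ /ord_inj /enum_rank_inj. Qed.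

Let key_homo a (x y : P) : x <= y -> key a x <= key a y.
Proof.
rewrite le_eqVlt => /predU1P[-> //|xy].
have h : (#|[set z | (z <= x)%O]| < #|[set z | (z <= y)%O]|)%N.
  apply: proper_card; apply/properP; split.
    by apply/subsetP => z; rewrite !inE => /le_trans; apply; exact: ltW.
  by exists y; rewrite !inE // lt_geF.
rewrite /key !lexi_pair /=.
have f : ((a <= x)%O <= (a <= y)%O)%N.
  by case: (boolP (a <= x)) => // /le_trans/(_ (ltW xy)) ->.
rewrite !leEnat f /=; apply/implyP => _.
by rewrite (ltnW h) leqNgt h.
Qed.

Let ext_linear a : linear_extension (ext a).
Proof.
split; rewrite /ext.
- by move=> x.
- by move=> x y /le_anti /key_inj.
- by move=> y x z; exact: le_trans.
- by move=> x y; exact: le_total.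
- exact: key_homo.
Qed.

Lemma intersection_of_linear_extensions_exists :
  exists n, `[< intersection_of_linear_extensions P n >].
Proof.
exists #|P|; apply/asboolP; exists (fun i => ext (enum_val i)).
split=> [i|x y]; first exact: ext_linear.
split=> [xy i|H]; first exact: key_homo.
have := H (enum_rank x); rewrite enum_rankK /ext /key lexi_pair lexx.
by case: (x <= y).
Qed.

End Existence.

Definition order_dimension {disp : Order.disp_t} (P : finPOrderType disp) : nat :=
  ex_minn (intersection_of_linear_extensions_exists P).

(* Main.v *)
Require Import Defs.
From mathcomp Require Import all_boot all_order.
From mathcomp Require Import boolp.

Set Implicit Arguments.
Unset Strict Implicit.
Unset Printing Implicit Defensive.

Import Order.TTheory.
Local Open Scope order_scope.

(** Linear extensions and order-preserving maps to the naturals are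
    interchangeable up to ties. A linear extension [L] gives the map
    [downset_card L], which strictly separates whatever [L] strictly separates,
    so the members of a realizer of [P] that refute [j <= m] reverse the pair
    [(j, m)]. Conversely, breaking the ties of an order-preserving map by a
    fixed linear extension of [P] gives a linear extension ([tiebreak_key]) that
    keeps every strict inequality between its values.

    Maps that reverse the subcritical pairs only are enough to recover [P],
    because every failure of [x <= y] is witnessed by a subcritical pair
    [(j, m)] with [j <= x] and [y <= m] ([subcritical_below_above]). A map
    [eta] reversing that pair satisfies
    [eta y <= eta m < eta j <= eta x], so the extension obtained from it
    does not place [x] below [y]. *)

Section DownsetCard.
Context {T : finType} (R : rel T).
Hypotheses (Rrefl : reflexive R) (Rtrans : transitive R).

Definition downset_card (x : T) : nat := #|[set z | R z x]|.

Lemma downset_card_homo x y : R x y -> (downset_card x <= downset_card y)%N.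
Proof.
move=> xy; apply: subset_leq_card; apply/subsetP => z; rewrite !inE => zx.
exact: Rtrans zx xy.
Qed.

Lemma downset_card_lt x y :
  R x y -> ~~ R y x -> (downset_card x < downset_card y)%N.
Proof.
move=> xy nyx; apply: proper_card; apply/properP; split.
  by apply/subsetP => z; rewrite !inE => zx; exact: Rtrans zx xy.
by exists y; rewrite !inE.
Qed.

End DownsetCard.

Section FinitePoset.
Context {disp : Order.disp_t} {P : finPOrderType disp}.
Implicit Types x y j m : P.

Lemma lt_downset_card x y :
  x < y -> (downset_card <=%O x < downset_card <=%O y)%N.
Proof.
move=> xy; apply: downset_card_lt; [exact: lexx|exact: le_trans|exact: ltW|].
by rewrite lt_geF.
Qed.

(** Among the elements below [x] but not below [y] take a minimal [j]; among the
    elements above [y] but not above [j] take a maximal [m]. Extremality of the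
    two choices is exactly what the last two conditions of subcriticality ask.
    Down-set size is strictly monotone, so optimizing it yields such
    extremal elements. *)
Lemma subcritical_below_above x y :
  ~~ (x <= y) -> exists j m, [/\ subcritical j m, j <= x & y <= m].
Proof.
move=> nxy.
have Px : (x <= x) && ~~ (x <= y) by rewrite lexx.
case: (arg_minnP (P := fun z => (z <= x) && ~~ (z <= y))
         (downset_card <=%O) Px) => j /andP[jx njy] jmin.
have Py : (y <= y) && ~~ (j <= y) by rewrite lexx.
case: (arg_maxnP (P := fun z => (y <= z) && ~~ (j <= z))
         (downset_card <=%O) Py) => m /andP[ym njm] mmax.
exists j, m; split=> //; split=> [|z zj|z mz]; first exact/negP.
- apply: le_trans ym; apply/negPn/negP => nzy.
  have zx := le_trans (ltW zj) jx.
  by have := jmin z; rewrite zx nzy leqNgt lt_downset_card // => /(_ isT).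
- apply/negPn/negP => njz.
  have yz := le_trans ym (ltW mz).
  by have := mmax z; rewrite yz njz /= leqNgt lt_downset_card // => /(_ isT).
Qed.

Lemma linear_extension_pullback d (T : orderType d) (f : P -> T) :
  injective f -> {homo f : x y / x <= y} ->
  linear_extension (fun x y => f x <= f y).
Proof.
move=> f_inj f_homo; split=> //.
- by move=> x y /le_anti /f_inj.
- by move=> y x z; exact: le_trans.
- by move=> x y; exact: le_total.
Qed.

(** Comparing down-set sizes before enumeration ranks makes the tie-breaking
    order-preserving; the enumeration rank alone would only make it injective. *)
Definition tiebreak_key (eta : P -> nat) x : nat *l (nat *l nat) :=
  (eta x, (downset_card <=%O x, nat_of_ord (enum_rank x))).

Lemma tiebreak_key_inj eta : injective (tiebreak_key eta).
Proof. by move=> x y [_ _ /ord_inj /enum_rank_inj]. Qed.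

Lemma tiebreak_key_homo eta :
  {homo eta : x y / x <= y} -> {homo tiebreak_key eta : x y / x <= y}.
Proof.
move=> eta_homo x y; rewrite le_eqVlt => /predU1P[-> //|xy].
have h := lt_downset_card xy.
rewrite /tiebreak_key !lexi_pair eta_homo ?(ltW xy) //=; apply/implyP => _.
by rewrite !leEnat (ltnW h) leqNgt h.
Qed.

Lemma tiebreak_key_lt eta x y :
  eta x < eta y -> ~~ (tiebreak_key eta y <= tiebreak_key eta x).
Proof. by move=> xy; rewrite /tiebreak_key lexi_pair (lt_geF xy). Qed.

Lemma reversing_maps_of_realizer n :
  intersection_of_linear_extensions P n ->
  exists eta : 'I_n -> P -> nat,
    (forall i, {homo eta i : x y / x <= y}) /\
    (forall j m, ~~ (j <= m) -> exists i, reverses (eta i) j m).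
Proof.
case=> L [L_lin L_cap]; exists (fun i => downset_card (L i)); split.
  move=> i x y xy; have [_ _ Ltr _ Lext] := L_lin i.
  by apply: downset_card_homo => //; exact: Lext.
move=> j m njm.
have [i nLjm] : exists i, ~~ L i j m.
  apply/existsP; rewrite -negb_forall; apply: contra njm => /forallP Ljm.
  exact/L_cap.
exists i; have [Lrefl _ Ltr Ltot _] := L_lin i.
apply: downset_card_lt => //.
by have := Ltot j m; rewrite (negbTE nLjm).
Qed.

Lemma realizer_of_reversing_maps n (eta : 'I_n -> P -> nat) :
  (forall i, {homo eta i : x y / x <= y}) ->
  (forall j m, subcritical j m -> exists i, reverses (eta i) j m) ->
  intersection_of_linear_extensions P n.
Proof.
move=> eta_homo eta_rev.
exists (fun i x y => tiebreak_key (eta i) x <= tiebreak_key (eta i) y).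
split=> [i|x y].
  apply: linear_extension_pullback; first exact: tiebreak_key_inj.
  exact: tiebreak_key_homo.
split=> [xy i|Lxy]; first exact: tiebreak_key_homo.
apply/negPn/negP => /subcritical_below_above[j [m [jm jx ym]]].
have [i mj] := eta_rev j m jm.
have yx : eta i y < eta i x.
  apply: le_lt_trans (eta_homo i _ _ ym) _.
  exact: lt_le_trans mj (eta_homo i _ _ jx).
by move/negP: (tiebreak_key_lt yx); apply; exact: Lxy.
Qed.

End FinitePoset.

Theorem proposition3p4 (disp : Order.disp_t) (P : finPOrderType disp) :
  is_smallest
    (fun d : nat => exists eta : 'I_d -> P -> nat,
       (forall i : 'I_d, {homo eta i : x y / x <= y}) /\
       (forall j m : P, subcritical j m ->
          exists i : 'I_d, reverses (eta i) j m))
    (order_dimension P).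
Proof.
rewrite /order_dimension; case: ex_minnP => n /asboolP Pn n_min; split.
  have [eta [eta_homo eta_rev]] := reversing_maps_of_realizer Pn.
  by exists eta; split=> // j m [/negP njm _ _]; exact: eta_rev.
move=> k [eta [eta_homo eta_rev]]; apply: n_min; apply/asboolP.
exact: realizer_of_reversing_maps eta_homo eta_rev.
Qed.
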